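(* Let $n,p\ge 1$, let $0<\mu\le L<\infty$, and let $f_1,\dots,f_n:\mathbb{R}^p\to\mathbb{R}$ be differentiable, $\mu$-strongly convex functions with $L$-Lipschitz continuous gradients. Let $x^*$ be the minimizer of $f=\frac1n\sum_{i=1}^n f_i$ and let $\kappa=L/\mu$. Let $(x^k)_{k\ge 0}$ be the sequence generated by the DIAG method from an arbitrary $x^0\in\mathbb{R}^p$ with stepsize $\epsilon=2/(\mu+L)$. Then for every $k\ge 0$, $$\|x^{k+1}-x^*\|\le \left(\frac{\kappa-1}{\kappa+1}\right)\left[\frac{\|x^k-x^*\|+\|x^{k-1}-x^*\|+\dots+\|x^{k-n+1}-x^*\|}{n}\right],$$ where $x^{j}:=x^0$ for negative indices $j<0$.
   Context: $\|\cdot\|$ is the Euclidean norm. A differentiable $f_i$ is $\mu$-strongly convex if $(\nabla f_i(x)-\nabla f_i(y))^T(x-y)\ge \mu\|x-y\|^2$ for all $x,y\in\mathbb{R}^p$; its gradient is $L$-Lipschitz if $\|\nabla f_i(x)-\nabla f_i(y)\|\le L\|x-y\|$ for all $x,y\in\mathbb{R}^p$. DIAG (Double Incremental Aggregated Gradient) method with stepsize $\epsilon$: given $x^0\in\mathbb{R}^p$, set $y_1^0=\dots=y_n^0=x^0$. For $k=0,1,2,\dots$, let $i^k=(k \bmod n)+1$, compute $$x^{k+1}=\frac1n\sum_{i=1}^n y_i^k-\frac{\epsilon}{n}\sum_{i=1}^n\nabla f_i(y_i^k),$$ and set $y_{i^k}^{k+1}=x^{k+1}$ and $y_i^{k+1}=y_i^k$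 for $i\ne i^k$. *)

(* Defs.v *)
From mathcomp Require Export all_boot all_order all_algebra.
From mathcomp Require Export all_classical all_reals all_analysis.

Set Implicit Arguments.
Unset Strict Implicit.
Unset Printing Implicit Defensive.

Export Order.TTheory GRing.Theory Num.Theory.
Export numFieldNormedType.Exports.

Local Open Scope ring_scope.

(* The library norm on matrices is the sup norm, so the Euclidean norm is
   defined here; the two norms induce the same topology on R^p, hence the
   library's [differentiable] on 'cV[R]_p is the usual notion. *)
Definition enorm (R : realType) (p : nat) (v : 'cV[R]_p) : R :=
  Num.sqrt (\sum_(j < p) v j 0 ^+ 2).

Definition dot (R : realType) (p : nat) (u v : 'cV[R]_p) : R :=
  (u^T *m v) 0 0.

Definition grad (R : realType) (p : nat) (f : 'cV[R]_p -> R) (x : 'cV[R]_p) :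
    'cV[R]_p :=
  \col_(j < p) 'D_(delta_mx j 0) f x.

Definition strongly_convex (R : realType) (p : nat) (mu : R)
    (f : 'cV[R]_p -> R) : Prop :=
  forall x y : 'cV[R]_p,
    mu * enorm (x - y) ^+ 2 <= dot (grad f x - grad f y) (x - y).

Definition lipschitz_gradient (R : realType) (p : nat) (L : R)
    (f : 'cV[R]_p -> R) : Prop :=
  forall x y : 'cV[R]_p, enorm (grad f x - grad f y) <= L * enorm (x - y).

Definition average (R : realType) (n p : nat) (f : 'I_n -> 'cV[R]_p -> R)
    (x : 'cV[R]_p) : R :=
  n%:R^-1 * \sum_(i < n) f i x.

Definition is_minimizer (R : realType) (p : nat) (f : 'cV[R]_p -> R)
    (xs : 'cV[R]_p) : Prop :=
  forall z : 'cV[R]_p, f xs <= f z.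

Definition diag_step (R : realType) (n p : nat) (f : 'I_n -> 'cV[R]_p -> R)
    (eps : R) (y : 'I_n -> 'cV[R]_p) : 'cV[R]_p :=
  n%:R^-1 *: (\sum_(i < n) y i) - (eps / n%:R) *: (\sum_(i < n) grad (f i) (y i)).

(* [diag_y f eps x0 k i] is y_{i+1}^k: component functions are numbered from 0,
   so the index refreshed at iteration k is k mod n. *)
Fixpoint diag_y (R : realType) (n p : nat) (f : 'I_n -> 'cV[R]_p -> R)
    (eps : R) (x0 : 'cV[R]_p) (k : nat) : 'I_n -> 'cV[R]_p :=
  match k with
  | 0%N => fun _ => x0
  | k'.+1 => fun i =>
      if (i : nat) == (k' %% n)%N then diag_step f eps (diag_y f eps x0 k')
      else diag_y f eps x0 k' i
  end.

Definition diag_x (R : realType) (n p : nat) (f : 'I_n -> 'cV[R]_p -> R)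
    (eps : R) (x0 : 'cV[R]_p) (k : nat) : 'cV[R]_p :=
  match k with
  | 0%N => x0
  | k'.+1 => diag_step f eps (diag_y f eps x0 k')
  end.

(* Extension to integer times, with x^j := x^0 for j < 0. *)
Definition diag_xz (R : realType) (n p : nat) (f : 'I_n -> 'cV[R]_p -> R)
    (eps : R) (x0 : 'cV[R]_p) (j : int) : 'cV[R]_p :=
  match j with
  | Posz k => diag_x f eps x0 k
  | Negz _ => x0
  end.

(* Main.v *)
(* Each gradient step z |-> z - eps grad f_i(z) with eps = 2/(mu+L) contracts by
   (L-mu)/(L+mu), by the strong form of cocoercivity
   mu L |D|^2 + |G|^2 <= (mu+L) <G,D> for D = x-y, G = grad f_i(x)-grad f_i(y).
   Since the gradients sum to 0 at the minimizer, x^{k+1} - x* is the average of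
   the differences of the gradient steps at y_i^k and at x*.  Finally, the indices
   are refreshed cyclically, so y_1^k, ..., y_n^k are x^k, ..., x^{k-n+1} in some
   order. *)

Require Import Defs.
From mathcomp Require Import ring lra zify.

Set Implicit Arguments.
Unset Strict Implicit.
Unset Printing Implicit Defensive.

Local Open Scope ring_scope.

(** * Euclidean inner product and norm *)

Section Euclidean.
Context {R : realType} {p : nat}.
Implicit Types (u v w : 'cV[R]_p) (a : R).

Lemma dotE u v : dot u v = \sum_(j < p) u j 0 * v j 0.
Proof. by rewrite /dot mxE; apply: eq_bigr => j _; rewrite mxE. Qed.

Lemma dotC u v : dot u v = dot v u.
Proof. by rewrite !dotE; apply: eq_bigr => j _; rewrite mulrC. Qed.

Lemma dotDl u v w : dot (u + v) w = dot u w + dot v w.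
Proof. by rewrite /dot linearD mulmxDl mxE. Qed.

Lemma dotZl a u w : dot (a *: u) w = a * dot u w.
Proof. by rewrite /dot linearZ -scalemxAl mxE. Qed.

Lemma dotNl u w : dot (- u) w = - dot u w.
Proof. by rewrite -scaleN1r dotZl mulN1r. Qed.

Lemma dotDr u v w : dot w (u + v) = dot w u + dot w v.
Proof. by rewrite dotC dotDl !(dotC w). Qed.

Lemma dotZr a u w : dot w (a *: u) = a * dot w u.
Proof. by rewrite dotC dotZl dotC. Qed.

Lemma dotNr u w : dot w (- u) = - dot w u.
Proof. by rewrite dotC dotNl dotC. Qed.

Definition dot_linE := (dotDl, dotDr, dotZl, dotZr, dotNl, dotNr).

Lemma dot_suml (I : finType) (u : I -> 'cV[R]_p) w :
  dot (\sum_i u i) w = \sum_i dot (u i) w.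
Proof.
elim/big_ind2: _ => // [|x x' y y' <- <-]; last by rewrite dotDl.
by rewrite -(scale0r 0) dotZl mul0r.
Qed.

Lemma dot_ge0 u : 0 <= dot u u.
Proof. by rewrite dotE sumr_ge0 // => j _; rewrite -expr2 sqr_ge0. Qed.

Lemma enorm_ge0 u : 0 <= enorm u.
Proof. exact: sqrtr_ge0. Qed.

Lemma sqr_enorm u : enorm u ^+ 2 = dot u u.
Proof.
rewrite /enorm sqr_sqrtr ?dotE; first by apply: eq_bigr => j _; rewrite expr2.
by rewrite sumr_ge0 // => j _; rewrite sqr_ge0.
Qed.

Lemma enorm_eq0 u : enorm u = 0 -> u = 0.
Proof.
move=> u0; have : dot u u = 0 by rewrite -sqr_enorm u0 expr0n.
rewrite dotE => /eqP; rewrite psumr_eq0; last first.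
  by move=> j _; rewrite -expr2 sqr_ge0.
move=> /allP u_eq0; apply/colP => j; rewrite mxE.
have /= := u_eq0 j (mem_index_enum j).
by rewrite mulf_eq0 orbb => /eqP.
Qed.

Lemma dot_le_enorm u v : dot u v <= enorm u * enorm v.
Proof.
have [u0|u_neq0] := eqVneq (enorm u) 0.
  by rewrite u0 (enorm_eq0 u0) -(scale0r 0) dotZl !mul0r.
have [v0|v_neq0] := eqVneq (enorm v) 0.
  by rewrite v0 (enorm_eq0 v0) -(scale0r 0) dotZr !(mul0r, mulr0).
have uv_gt0 : 0 < enorm u * enorm v.
  by rewrite mulr_gt0 // lt_def enorm_ge0 andbT.
(* Expanding this square gives 2 |u| |v| (|u| |v| - <u,v>) >= 0, which yields Cauchy-Schwarz after
   division. *)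
have := dot_ge0 (enorm v *: u - enorm u *: v).
rewrite !dot_linE (dotC v u) -!sqr_enorm => H.
by rewrite -(ler_pM2l uv_gt0); nra.
Qed.

Lemma le_enormP u a : 0 <= a -> dot u u <= a ^+ 2 -> enorm u <= a.
Proof. by move=> a_ge0; rewrite -sqr_enorm ler_sqr ?nnegrE ?enorm_ge0. Qed.

Lemma enorm0 : enorm (0 : 'cV[R]_p) = 0.
Proof.
by rewrite /enorm big1 ?sqrtr0 // => j _; rewrite mxE expr0n.
Qed.

Lemma enormD u v : enorm (u + v) <= enorm u + enorm v.
Proof.
apply: le_enormP; first by rewrite addr_ge0 ?enorm_ge0.
rewrite !dot_linE (dotC v u) -!sqr_enorm.
by have := dot_le_enorm u v; nra.
Qed.

Lemma enormZ a u : 0 <= a -> enorm (a *: u) = a * enorm u.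
Proof.
move=> a_ge0; rewrite -[in RHS](ger0_norm a_ge0) -sqrtr_sqr /enorm.
rewrite -sqrtrM ?sqr_ge0 // mulr_sumr.
by congr Num.sqrt; apply: eq_bigr => j _; rewrite mxE exprMn.
Qed.

Lemma enorm_sum (I : finType) (u : I -> 'cV[R]_p) :
  enorm (\sum_i u i) <= \sum_i enorm (u i).
Proof.
elim/big_ind2: _ => // [|x x' y y' hx hy]; first by rewrite enorm0.
exact: le_trans (enormD _ _) (lerD hx hy).
Qed.

End Euclidean.

(** * Quadratic bounds and gradient steps for a single function *)

Section Smooth.
Context {R : realType} {p : nat} (f : 'cV[R]_p -> R).
Hypothesis fdiff : forall x, differentiable f x.

(** [grad] only records partial derivatives; differentiability makes the derivative linear in the
    direction, so they determine it. *)
Lemma deriveE_dot x d : 'D_d f x = dot (grad f x) d.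
Proof.
rewrite deriveE // {1}[d]matrix_sum_delta linear_sum dotE.
apply: eq_bigr => j _; rewrite big_ord1 linearZ /= mxE deriveE //.
by rewrite [RHS]mulrC.
Qed.

Lemma is_derive_line x d (t : R) :
  is_derive t 1 (fun s : R => f (x + s *: d)) (dot (grad f (x + t *: d)) d).
Proof.
have E : (fun h : R => h^-1 *: (((fun s : R => f (x + s *: d)) \o shift t)
           (h *: (1 : R)) - f (x + t *: d))) =
         (fun h : R => h^-1 *: ((f \o shift (x + t *: d)) (h *: d)
           - f (x + t *: d))).
  apply/funext => h /=; congr (_ *: (f _ - _)).
  by rewrite [h *: (1 : R)]mulr1 scalerDl addrCA.
apply: DeriveDef.
  rewrite /derivable E; exact: diff_derivable.
by rewrite -deriveE_dot /derive E.
Qed.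

(** Mean value theorem on [0,1] for f along the segment minus a quadratic in t. Taking [c] to be L
    or mu makes the right-hand side <= 0 or >= 0, so both quadratic bounds follow from it. *)
Lemma line_mean_value x d (c : R) : exists2 t, 0 < t &
  f (x + d) - f x - dot (grad f x) d - c / 2 * enorm d ^+ 2 =
  dot (grad f (x + t *: d) - grad f x) d - c * t * enorm d ^+ 2.
Proof.
pose a := dot (grad f x) d; pose b := c / 2 * enorm d ^+ 2.
pose g (t : R) := f (x + t *: d) - a * t - b * t ^+ 2.
pose dg (t : R) := dot (grad f (x + t *: d)) d - a - b * (2 * t).
have gder (t : R) : is_derive t 1 g (dg t).
  have ? := is_derive_line x d t.
  apply: is_derive_eq.
  rewrite /dg; congr (_ - _ - _); rewrite /GRing.scale /=; ring.
have gcont : {within `[0, 1], continuous g}%classic.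
  by apply: derivable_within_continuous => t _; apply: ex_derive.
have [t] := MVT ltr01 (fun t _ => gder t) gcont.
rewrite in_itv /= => /andP[t_gt0 _] E; exists t => //.
move: E; rewrite /g /dg scale1r scale0r addr0 dotDl dotNl -/a -/b subr0 mulr1.
have -> : c * t * enorm d ^+ 2 = b * (2 * t) by rewrite /b; field.
by lra.
Qed.

Lemma smooth_upper L x d : lipschitz_gradient L f ->
  f (x + d) <= f x + dot (grad f x) d + L / 2 * enorm d ^+ 2.
Proof.
move=> flip; have [t t_gt0 E] := line_mean_value x d L.
suff: dot (grad f (x + t *: d) - grad f x) d <= L * t * enorm d ^+ 2 by lra.
apply: le_trans (dot_le_enorm _ _) _; rewrite expr2 mulrA.
apply: ler_wpM2r; first exact: enorm_ge0.
apply: le_trans (flip _ _) _.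
by rewrite addrAC subrr add0r enormZ ?mulrA // ltW.
Qed.

Lemma strongly_convex_lower mu x d : strongly_convex mu f ->
  f x + dot (grad f x) d + mu / 2 * enorm d ^+ 2 <= f (x + d).
Proof.
move=> fconv; have [t t_gt0 E] := line_mean_value x d mu.
suff: mu * t * enorm d ^+ 2 <= dot (grad f (x + t *: d) - grad f x) d by lra.
have := fconv (x + t *: d) x.
rewrite [x + _ - x]addrAC subrr add0r enormZ ?(ltW t_gt0) // dotZr.
by move=> H; rewrite -(ler_pM2l t_gt0); apply: le_trans H; lra.
Qed.

(* Interpolating between the quadratic lower bound at one point and the
   quadratic upper bound at the other, with an optimal displacement [w]. *)
Lemma strong_cocoercivity mu L x y : 0 < mu -> mu <= L ->
  strongly_convex mu f -> lipschitz_gradient L f ->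
  mu * L * dot (x - y) (x - y) + dot (grad f x - grad f y) (grad f x - grad f y)
  <= (mu + L) * dot (grad f x - grad f y) (x - y).
Proof.
move=> mu_gt0 muL fconv flip; set D := x - y; set G := grad f x - grad f y.
have GD : mu * dot D D <= dot G D by rewrite -sqr_enorm; exact: fconv.
(* Two paths, through y + w and through x - w, each pair a lower with an upper bound; adding all
   four inequalities cancels the values of f. *)
have key w : 2 * dot G w + mu * dot D D - 2 * mu * dot w D
             - (L - mu) * dot w w <= dot G D.
  have l1 := strongly_convex_lower x (w - D) fconv.
  have u1 := smooth_upper y w flip.
  have l2 := strongly_convex_lower y (D - w) fconv.
  have u2 := smooth_upper x (- w) flip.
  have E1 : x + (w - D) = y + w.
    by rewrite /D opprB addrCA subrKC addrC.
  have E2 : y + (D - w) = x - w by rewrite addrA subrKC.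
  clearbody D; move: l1 u1 l2 u2; rewrite E1 E2 !sqr_enorm.
  by rewrite /G !dot_linE (dotC D w); lra.
(* If L = mu the optimal [w] below would divide by 0; there |G| <= mu |D| and [GD] suffice. *)
have [{}muL|] := ltP mu L; last first.
  move=> Lmu; have {muL Lmu} LE : L = mu by apply/eqP; rewrite eq_le Lmu.
  have := flip x y; rewrite -/D -/G LE => H.
  have : dot G G <= mu ^+ 2 * dot D D.
    rewrite -!sqr_enorm -exprMn ler_sqr ?nnegrE ?enorm_ge0 //.
    exact: le_trans (enorm_ge0 _) H.
  by have := ler_wpM2l (ltW mu_gt0) GD; lra.
clearbody D G; pose c := (L - mu)^-1.
have Hc : (L - mu) * c = 1 by rewrite mulfV // subr_eq0 gt_eqF.
(* This [w] maximizes the left side of [key], a concave quadratic in [w]. *)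
have := key (c *: (G - mu *: D)).
rewrite !dot_linE (dotC D G) => H.
suff: (L - mu) * (c * (dot G G - 2 * mu * dot G D + mu ^+ 2 * dot D D)
                  + mu * dot D D) <= (L - mu) * dot G D.
  by rewrite mulrDr mulrA Hc mul1r; lra.
rewrite ler_pM2l ?subr_gt0 //; apply: le_trans H.
set Z := dot G G - _ + _.
have : (L - mu) * (c * c * Z) = c * Z by rewrite !mulrA Hc mul1r.
by rewrite /Z; lra.
Qed.

(** In |D - eps G|^2, cocoercivity times eps^2 = 4/(mu+L)^2 absorbs exactly the cross term and
    |G|^2, leaving the factor 1 - 4 mu L/(mu+L)^2 = ((L-mu)/(L+mu))^2 on |D|^2. *)
Lemma gradient_step_contraction mu L x y : 0 < mu -> mu <= L ->
  strongly_convex mu f -> lipschitz_gradient L f ->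
  enorm (x - y - (2 / (mu + L)) *: (grad f x - grad f y)) <=
  (L - mu) / (L + mu) * enorm (x - y).
Proof.
move=> mu_gt0 muL fconv flip.
have L_gt0 : 0 < L := lt_le_trans mu_gt0 muL.
have := strong_cocoercivity x y mu_gt0 muL fconv flip.
set D := x - y; set G := grad f x - grad f y; clearbody D G => coco.
pose c := (mu + L)^-1; have c_ge0 : 0 <= c by rewrite invr_ge0 addr_ge0 ?ltW.
have Hc : (mu + L) * c = 1 by rewrite mulfV // gt_eqF ?addr_gt0.
have -> : 2 / (mu + L) = 2 * c by [].
have -> : (L - mu) / (L + mu) = (L - mu) * c by rewrite (addrC L mu).
apply: le_enormP; first by rewrite !mulr_ge0 ?enorm_ge0 ?subr_ge0.
rewrite exprMn sqr_enorm !dot_linE (dotC D G).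
have cc r : (mu + L) * c * (c * r) = c * r by rewrite Hc mul1r.
have ccD : ((mu + L) * c) ^+ 2 * dot D D = dot D D by rewrite Hc expr1n mul1r.
have := ler_wpM2l (mulr_ge0 c_ge0 c_ge0) coco.
have := cc (dot G D); lra.
Qed.

End Smooth.

(* Otherwise the step [- S / (n L)] along the gradient sum [S] would decrease the
   quadratic upper bound of the average. *)
Lemma sum_grad_minimizer (R : realType) (n p : nat) (L : R)
    (f : 'I_n -> 'cV[R]_p -> R) (xs : 'cV[R]_p) : (0 < n)%N -> 0 < L ->
  (forall i x, differentiable (f i) x) ->
  (forall i, lipschitz_gradient L (f i)) ->
  is_minimizer (average f) xs -> \sum_i grad (f i) xs = 0.
Proof.
move=> n_gt0 L_gt0 fdiff flip xsmin; set S := \sum_i _.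
have nR_gt0 : 0 < n%:R :> R by rewrite ltr0n.
pose c : R := (n%:R * L)^-1; have c_gt0 : 0 < c by rewrite invr_gt0 mulr_gt0.
have cE : n%:R * L * c = 1 by rewrite mulfV // gt_eqF // mulr_gt0.
have := xsmin (xs - c *: S); rewrite /average ler_pM2l ?invr_gt0 // => le1.
have le2 : \sum_i f i (xs - c *: S) <=
    \sum_i (f i xs + dot (grad (f i) xs) (- (c *: S))
             + L / 2 * enorm (- (c *: S)) ^+ 2).
  by apply: ler_sum => i _; apply: smooth_upper.
have := le_trans le1 le2.
rewrite !big_split /= -dot_suml -/S sumr_const card_ord -mulr_natl.
rewrite sqr_enorm; clearbody S; rewrite !dot_linE -sqr_enorm => le3.
(* With this [c] the quadratic term is half the linear one, so [le3] reads 0 <= - (c/2) |S|^2. *)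
have E : n%:R * L * c * (c * enorm S ^+ 2) = c * enorm S ^+ 2.
  by rewrite cE mul1r.
apply: enorm_eq0; apply/eqP; rewrite -sqrf_eq0 eq_le sqr_ge0 andbT.
by rewrite -(ler_pM2l c_gt0) mulr0; lra.
Qed.

(** * Ages of the stored points and the DIAG iteration *)

(** The remainder is the age of the stored point, (k - 1 - i) mod n, with n added to keep the
    subtraction in nat. An index not yet refreshed has i >= k, so its time k - age is at most 0 and
    gives [x0]. *)
Lemma diag_yE (R : realType) (n p : nat) (f : 'I_n -> 'cV[R]_p -> R) (eps : R)
    (x0 : 'cV[R]_p) (k : nat) (i : 'I_n) :
  diag_y f eps x0 k i =
  diag_xz f eps x0 (k%:Z - ((k + n.-1 - i) %% n)%N%:Z).
Proof.
have n_gt0 : (0 < n)%N by case: n i {f} => // -[].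
have ltin := ltn_ord i.
elim: k => [|k IHk] /=; first by case: (_ %% _)%N.
have E : (k.+1 + n.-1 - i = (k + n.-1 - i).+1)%N by lia.
case: eqP => [ik|/eqP ik].
  have -> : ((k.+1 + n.-1 - i) %% n = 0)%N.
    have -> : (k.+1 + n.-1 - i = (k %/ n).+1 * n)%N; last exact: modnMl.
    by have := divn_eq k n; rewrite -ik mulSn; lia.
  by rewrite subr0.
rewrite IHk E; congr diag_xz.
(* Without a refresh the age grows by one; it could wrap around only from n - 1, which would force i
   = k mod n. *)
have -> : ((k + n.-1 - i).+1 %% n = ((k + n.-1 - i) %% n).+1)%N; last by lia.
have := ltn_pmod (k + n.-1 - i) n_gt0; rewrite leq_eqVlt => /orP[/eqP eqn|lt].
  case/negP: ik; have := divn_eq (k + n.-1 - i) n; set q := (_ %/ n)%N => Ek.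
  have -> : k = (q * n + i)%N by lia.
  by rewrite modnMDl modn_small.
by rewrite -[in LHS]addn1 -modnDml addn1 modn_small.
Qed.

(** At a fixed time distinct indices have distinct ages, since |i - j| < n, so the ages permute 0,
    ..., n-1. *)
Lemma sum_diag_y (R : realType) (n p : nat) (f : 'I_n -> 'cV[R]_p -> R)
    (eps : R) (x0 : 'cV[R]_p) (k : nat) (F : 'cV[R]_p -> R) :
  \sum_i F (diag_y f eps x0 k i) =
  \sum_(i < n) F (diag_xz f eps x0 (k%:Z - i%:Z)).
Proof.
case: n f => [|n] f; first by rewrite !big_ord0.
pose h (i : 'I_n.+1) : 'I_n.+1 := inord ((k + n - i) %% n.+1).
have hE i : (h i = (k + n - i) %% n.+1 :> nat)%N by rewrite inordK ?ltn_pmod.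
have h_inj : injective h.
  move=> i j /(congr1 val); rewrite /= !hE => /eqP hij; apply: val_inj => /=.
  have := ltn_ord i; have := ltn_ord j.
  wlog le_ij : i j hij / (i <= j)%N.
    move=> W ltj lti; case: (leqP i j) => [/W|/ltnW/W W']; first exact.
    by symmetry; apply: W'; rewrite // eq_sym.
  move=> ltj lti; move: hij; rewrite eqn_mod_dvd; last by lia.
  have -> : (k + n - i - (k + n - j) = j - i)%N by lia.
  by rewrite /dvdn modn_small; lia.
rewrite [RHS](reindex_inj h_inj); apply: eq_bigr => i _.
by rewrite diag_yE hE.
Qed.

Theorem lemma1 (R : realType) (n p : nat) (hn : (1 <= n)%N) (hp : (1 <= p)%N)
  (mu L : R) (hmu : 0 < mu) (hmuL : mu <= L)
  (f : 'I_n -> 'cV[R]_p -> R)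
  (hdiff : forall (i : 'I_n) (x : 'cV[R]_p), differentiable (f i) x)
  (hconv : forall i : 'I_n, strongly_convex mu (f i))
  (hlip : forall i : 'I_n, lipschitz_gradient L (f i))
  (xs : 'cV[R]_p) (hxs : is_minimizer (average f) xs)
  (x0 : 'cV[R]_p) :
  let kappa := L / mu in
  let eps := 2 / (mu + L) in
  let x := diag_xz f eps x0 in
  forall k : nat,
    enorm (x (k%:Z + 1) - xs) <=
      ((kappa - 1) / (kappa + 1)) *
      ((\sum_(i < n) enorm (x (k%:Z - i%:Z) - xs)) / n%:R).
Proof.
move=> kappa eps x k.
have L_gt0 : 0 < L := lt_le_trans hmu hmuL.
have nR_gt0 : 0 < n%:R :> R by rewrite ltr0n.
have -> : (kappa - 1) / (kappa + 1) = (L - mu) / (L + mu).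
  by rewrite /kappa; field; rewrite !gt_eqF ?addr_gt0.
have grad0 := sum_grad_minimizer hn L_gt0 hdiff hlip hxs.
rewrite -(sum_diag_y f eps x0 k (fun z => enorm (z - xs))).
set y := diag_y f eps x0 k.
have -> : x (k%:Z + 1) = diag_step f eps y by rewrite -PoszD addn1.
(* Subtracting the gradients at [xs] changes nothing, as [grad0] says that they sum to 0. *)
have -> : diag_step f eps y - xs =
    n%:R^-1 *: \sum_i (y i - xs - eps *: (grad (f i) (y i) - grad (f i) xs)).
  rewrite !sumrB -scaler_sumr sumrB grad0 subr0 sumr_const card_ord.
  rewrite /diag_step !scalerBr -(scaler_nat n xs) !scalerA.
  by rewrite mulVf ?gt_eqF // scale1r addrAC (mulrC eps).
rewrite enormZ ?invr_ge0 ?ler0n // mulrA [_ / n%:R]mulrC.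
rewrite ler_pM2l ?invr_gt0 //; apply: le_trans (enorm_sum _) _.
rewrite mulr_sumr; apply: ler_sum => i _.
exact: gradient_step_contraction.
Qed.
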